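(* Let $T\ge1$, $n_1,\ldots,n_T\ge1$, $n=n_1+\cdots+n_T$, and $z_1,z_2,\ldots$ positive reals. Consider the enriched multispecies juggling chain on the set $\mathcal{S}_{n_1,\ldots,n_T}$ of enriched states described in the context. Then the probability distribution $$\tilde\pi(w,v)=\frac{1}{Z}\prod_{i=1}^n z_{v_i},\qquad (w,v)\in\mathcal{S}_{n_1,\ldots,n_T},$$ where $Z$ is the normalization constant making the total mass $1$, is a stationary distribution of this chain.
   Context: $St_{n_1,\ldots,n_T}$ is the set of words $w=w_1\cdots w_n$ over $\{1,\ldots,T\}$ with exactly $n_i$ occurrences of $i$; convention $w_{n+1}=\infty$. Let $y_i=z_1+\cdots+z_i$, $J_w(m,t)=1+\#\{\ell:\ m\le \ell\le n,\ w_\ell>t\}$ for $m\in\{1,\ldots,n+1\}$, and $E_w(i)=J_w(i,w_i)$. An enriched state is a pair $(w,v)$ with $w\in St_{n_1,\ldots,n_T}$ and $v=v_1\cdots v_n$ a sequence of positive integers with $v_i\le E_w(i)$ for all $i$. A bumping sequence for $w$ is an increasing integer sequence $a(1)<\cdots<a(k)$ with $a(1)=1$, $a(k)=n+1$, $w_{a(j)}<w_{a(j+1)}$ for $1\le j\le k-1$. Define $w'=w^a$ by $w'_i=w_{a(\ell-1)}$ if $i=a(\ell)-1$ for some $\ell\in\{2,\ldots,k\}$ and $w'_i=w_{i+1}$ otherwise, and $v'$ by $v'_i=E_{w'}(i)$ if $i=a(\ell)-1$ for some $\ell\in\{2,\ldots,k\}$ and $v'_i=v_{i+1}$ otherwise;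 set $(w,v)^a=(w',v')$. The transition probability from $(w,v)$ to $(w',v')$ is $\prod_{i=2}^k \dfrac{z_{J_w(a(i),w_{a(i-1)})}}{y_{J_w(a(i-1),w_{a(i-1)})}}$ if $(w',v')=(w,v)^a$ for some bumping sequence $a$ of $w$, and $0$ otherwise. *)

(* Defs.v *)
From HB Require Import structures.
From mathcomp Require Import all_boot all_order all_algebra.

Set Implicit Arguments.
Unset Strict Implicit.
Unset Printing Implicit Defensive.

Import Order.TTheory GRing.Theory Num.Theory.

(* Positions and letters are 1-based: a word w_1 ... w_n is handled as a
   function u : nat -> nat of which only u 1, ..., u n and u n.+1 matter.
   Likewise a bumping sequence a(1) < ... < a(k) is a seq nat, read by [entry]. *)

Section Words.
Variable n : nat.
Implicit Types (u x : nat -> nat) (a : seq nat).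

Definition entry a j : nat := nth 0 a j.-1.

Definition J u m t : nat := 1 + count (fun l => t < u l) (index_iota m n.+1).

Definition E u i : nat := J u i (u i).

Definition bumping_seq u a : bool :=
  [&& sorted ltn a, head 0 a == 1, last 0 a == n.+1
    & [forall j : 'I_(size a), (0 < j) ==> (u (entry a j) < u (entry a j.+1))]].

(* i = a(l) - 1 for some l in {2, ..., k} *)
Definition bumped a i : bool := i.+1 \in behead a.

(* when i = a(l) - 1, this is l; it is unique as a is increasing *)
Definition bump_rank a i : nat := (index i.+1 a).+1.

Definition bump_word u a i : nat :=
  if bumped a i then u (entry a (bump_rank a i).-1) else u i.+1.

Definition bump_mark u x a i : nat :=
  if bumped a i then E (bump_word u a) i else x i.+1.

End Words.

Section States.
Variables (T : nat) (nn : 'I_T -> nat).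

Definition len : nat := \sum_i nn i.

(* The ordinal c : 'I_T stands for the letter c.+1; reading past the end of w,
   in particular at position len.+1, gives T.+1, which plays the role of
   infinity since every letter is at most T. *)
Definition letter (w : len.-tuple 'I_T) (i : nat) : nat :=
  nth T.+1 [seq (val c).+1 | c <- w] i.-1.

Definition St : {set len.-tuple 'I_T} :=
  [set w : len.-tuple 'I_T | [forall c : 'I_T, count_mem c w == nn c]].

Definition mark (v : len.-tuple 'I_len.+2) (i : nat) : nat :=
  nth 0 [seq val c | c <- v] i.-1.

(* Taking v in 'I_len.+2 loses no state: J, hence E, is at most len.+1. *)
Definition is_enriched (s : len.-tuple 'I_T * len.-tuple 'I_len.+2) : bool :=
  (s.1 \in St) &&
  [forall i : 'I_len, 0 < mark s.2 i.+1 <= E len (letter s.1) i.+1].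

Definition enriched_state := {s | is_enriched s}.

Definition wordof (s : enriched_state) : nat -> nat := letter (val s).1.
Definition markof (s : enriched_state) : nat -> nat := mark (val s).2.

(* s' = s^a *)
Definition is_bump (s s' : enriched_state) (a : seq nat) : bool :=
  [forall i : 'I_len,
    (wordof s' i.+1 == bump_word (wordof s) a i.+1) &&
    (markof s' i.+1 == bump_mark len (wordof s) (markof s) a i.+1)].

(* An increasing sequence in {1, ..., len.+1} has at most len.+1 terms, so
   every bumping sequence is the value of some element of this finite type. *)
Definition seq_index := {bseq len.+1 of 'I_len.+2}.
Definition seq_of (b : seq_index) : seq nat := [seq val p | p <- b].

Local Open Scope ring_scope.
Variables (R : realFieldType) (z : nat -> R).

Definition y (i : nat) : R := \sum_(1 <= j < i.+1) z j.

Definition bump_weight (u : nat -> nat) (a : seq nat) : R :=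
  \prod_(2 <= i < (size a).+1)
    (z (J len u (entry a i) (u (entry a i.-1)))
     / y (J len u (entry a i.-1) (u (entry a i.-1)))).

(* At most one bumping sequence a satisfies s' = s^a (the word of s' already
   determines a), so the choice made by [pick] is immaterial. *)
Definition transition (s s' : enriched_state) : R :=
  if [pick b : seq_index |
       bumping_seq len (wordof s) (seq_of b) && is_bump s s' (seq_of b)]
  is Some b then bump_weight (wordof s) (seq_of b) else 0.

Definition state_weight (s : enriched_state) : R :=
  \prod_(1 <= i < len.+1) z (markof s i).

Definition Z : R := \sum_(s : enriched_state) state_weight s.

Definition pi_tilde (s : enriched_state) : R := Z^-1 * state_weight s.

End States.

Local Open Scope ring_scope.

Definition is_distribution (R : realFieldType) (S : finType) (p : S -> R) :=
  (forall s, 0 <= p s) /\ \sum_s p s = 1.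

Definition stationary_distribution (R : realFieldType) (S : finType)
    (P : S -> S -> R) (p : S -> R) :=
  is_distribution p /\ forall s', \sum_s p s * P s s' = p s'.

(* Main.v *)
Require Import Defs.
From HB Require Import structures.
From mathcomp Require Import all_boot all_order all_algebra.
From mathcomp Require Import zify.

Set Implicit Arguments.
Unset Strict Implicit.
Unset Printing Implicit Defensive.

Import Order.TTheory GRing.Theory Num.Theory.

(** The target [(w', v')] of a transition determines its bumping sequence.
    Scan [w'] from right to left holding a letter [c], initially infinity: a
    bump leaves at position [i] a letter smaller than [c], with the maximal mark
    [v'_i = E_{w'}(i)], and then [c] becomes [w'_i]; conversely, if [w'_i < c]
    and [v'_i] is maximal but [i] is not bumped, the mark at [i + 1] in the
    source would exceed its bound. Hence all sources of [(w', v')] share the same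
    word and sequence and differ only in the marks at the positions [a(j)],
    [j < k], which are free; summing over these marks gives the product of the
    [y_{E_w(a(j))}], which cancels the denominators of the transition
    probability. As [J_w(a(j), w_{a(j-1)}) = E_{w'}(a(j) - 1) = v'_{a(j) - 1}],
    what remains is the weight of [(w', v')]. *)

(** * Ranks and maxima in increasing sequences *)

Lemma count_ltn_sorted (a : seq nat) x :
  sorted ltn a -> x \in a -> count (fun p => p < x) a = index x a.
Proof.
elim: a => //= b a IHa pa; rewrite inE eq_sym.
have := order_path_min ltn_trans pa => /allP mina.
case: eqVneq => [<- _|nbx /= xa]; last first.
  by rewrite (mina _ xa) IHa // (path_sorted pa).
rewrite ltnn add0n; apply/eqP; rewrite -leqn0 leqNgt -has_count.
by apply/hasPn => p /mina; rewrite -leqNgt => /ltnW.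
Qed.

Lemma count_leqS (a : seq nat) i : uniq a ->
  count (fun p => p <= i.+1) a = count (fun p => p <= i) a + (i.+1 \in a).
Proof.
move=> ua; rewrite -count_uniq_mem //; elim: a {ua} => //= b a ->; lia.
Qed.

Lemma sorted_leq_last (a : seq nat) i :
  sorted ltn a -> i \in a -> i <= last 0 a.
Proof.
case: a => //= b s; elim: s b i => [|b' s IHs] b i /=; first by rewrite inE => _ /eqP ->.
move=> /andP[bb' ps]; rewrite inE => /predU1P[->|]; last exact: IHs.
by rewrite (leq_trans (ltnW bb')) // IHs // mem_head.
Qed.

(** * The letter in hand along a bumping sequence *)

Section Carry.
Variables (n : nat) (u : nat -> nat) (a : seq nat).
Hypotheses (sa : sorted ltn a) (ha : head 0 a = 1).

(** The letter in hand once position [i] has been read: the predecessor of the count is the 0-based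
    rank of the last entry met so far. *)
Definition carry i := u (nth 0 a (count (fun p => p <= i) a).-1).

Lemma bump_seq_uniq : uniq a.
Proof. exact: (sorted_uniq ltn_trans ltnn sa). Qed.

Lemma one_in_bump_seq : 1 \in a.
Proof. by move: ha; case: (a) => //= b s ->; rewrite inE eqxx. Qed.

Lemma bump_seq_gt0 i : i \in a -> 0 < i.
Proof.
move: ha sa; case: (a) => //= b s -> /(order_path_min ltn_trans) /allP mins.
by rewrite inE => /predU1P[->//|/mins]; lia.
Qed.

Lemma mem_behead_bump_seq i : 0 < i -> (i.+1 \in behead a) = (i.+1 \in a).
Proof. by move: ha; case: (a) => //= b s ->; rewrite inE; case: i. Qed.

Lemma count_leq_bump_seq i : i.+1 \in a ->
  count (fun p => p <= i) a = index i.+1 a.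
Proof. by move=> ia; rewrite -count_ltn_sorted. Qed.

Lemma index_bump_seq_gt0 i : 0 < i -> 0 < index i.+1 a.
Proof. by move: ha; case: (a) => //= b s ->; case: i. Qed.

Lemma carry1 : carry 1 = u 1.
Proof.
rewrite /carry count_leqS ?bump_seq_uniq // one_in_bump_seq addn1 /=.
by rewrite (@count_leq_bump_seq 0) ?one_in_bump_seq // nth_index ?one_in_bump_seq.
Qed.

Lemma carryS i : carry i.+1 = if i.+1 \in a then u i.+1 else carry i.
Proof.
rewrite /carry count_leqS ?bump_seq_uniq //; case: ifP => ia; last by rewrite addn0.
by rewrite addn1 /= count_leq_bump_seq // nth_index.
Qed.

Lemma bump_wordE i : 0 < i ->
  bump_word u a i = if i.+1 \in a then carry i else u i.+1.
Proof.
move=> i0; rewrite /bump_word /bumped mem_behead_bump_seq //; case: ifP => // ia.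
by rewrite /carry count_leq_bump_seq.
Qed.

Lemma carry_nth j : 0 < j < size a -> carry (nth 0 a j).-1 = u (nth 0 a j.-1).
Proof.
case/andP=> j0 jk; have aj := mem_nth 0 jk; have := bump_seq_gt0 aj.
move Ei : (nth 0 a j) aj => [//|i] aj _ /=; rewrite /carry count_leq_bump_seq //.
by rewrite -Ei index_uniq // bump_seq_uniq.
Qed.

(** Trades ranks for positions: when [i.+1] is an entry other than the first, [carry i] is the
    letter at the previous entry. *)
Lemma bumping_seqP : last 0 a = n.+1 ->
  reflect (forall i, 0 < i -> i.+1 \in a -> carry i < u i.+1)
          (bumping_seq n u a).
Proof.
move=> la; rewrite /bumping_seq sa ha la !eqxx /=.
apply: (iffP forallP) => [H i i0 ia|H [j jk]].
  have := index_bump_seq_gt0 i0; have := ia; rewrite -index_mem => ik j0.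
  have /implyP := H (Ordinal ik); move/(_ j0).
  by rewrite /entry /= nth_index // /carry count_leq_bump_seq.
apply/implyP => /= j0; rewrite /entry /= -carry_nth ?j0 //.
have aj := mem_nth 0 jk; have := bump_seq_gt0 aj.
have : nth 0 a j != 1.
  rewrite -ha -nth0 nth_uniq ?bump_seq_uniq //; last by case: (a) jk.
  by rewrite -lt0n.
case: (nth 0 a j) aj => [//|[//|i]] ai _ _; exact: H.
Qed.

End Carry.

(* The letter-by-letter description of a bump: [c i] is the letter in hand
   before position [i.+1] is read, and [A] is the set of bumping positions. *)
Definition bump_rel n (u w c : nat -> nat) (A : pred nat) :=
  [/\ c 1 = u 1, c n.+1 = u n.+1 &
   forall i, 0 < i <= n ->
     if A i.+1 then w i = c i /\ c i.+1 = u i.+1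
     else w i = u i.+1 /\ c i.+1 = c i].

(** * Conservation of letters and change of the bounds [E] under a bump *)

Section BumpRel.
Variables (n : nat) (u w c : nat -> nat) (A : pred nat).
Hypothesis H : bump_rel n u w c A.

(** A bump loses no letter: what is still to be read in [u], position [n.+1] included, together with
    the letter in hand, ends up in [w] from [i] on, except for [u n.+1], which stays in hand.
    Descending induction on [i]. *)
Lemma count_bump_rel (P : pred nat) i : 0 < i <= n.+1 ->
  count (fun l => P (w l)) (index_iota i n.+1) + P (u n.+1)
  = count (fun l => P (u l)) (index_iota i.+1 n.+2) + P (c i).
Proof.
case: H => c1 cn Hi; case/andP=> i0; move Ek : (n.+1 - i) => k.
elim: k i i0 Ek => [|k IHk] i i0 Ek ile.
  have -> : i = n.+1 by lia.
  by rewrite /index_iota !subnn /= cn.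
have lin : i < n.+1 by lia.
rewrite /index_iota Ek subSS Ek /=; have := IHk i.+1 isT.
rewrite /index_iota !subSS.
have -> : n - i = k by lia.
move=> /(_ erefl lin).
have /Hi : 0 < i <= n by lia.
case: ifP => _ [-> ->]; lia.
Qed.

Lemma count_bump_rel1 (P : pred nat) :
  count (fun l => P (w l)) (index_iota 1 n.+1)
  = count (fun l => P (u l)) (index_iota 1 n.+1).
Proof.
have := @count_bump_rel P 1; case: H => -> _ _ /(_ isT).
rewrite /index_iota !subSS !subn0 => Hc.
have := congr1 (count (fun l => P (u l))) (iotaD 1 n 1).
rewrite addn1 count_cat /= add1n addn0; lia.
Qed.

(** The letter [u n.+1] is counted on both sides of [count_bump_rel] and cancels. *)
Lemma J_bump_rel i t : 0 < i <= n -> J n w i t = J n u i.+1 t + (t < c i).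
Proof.
case/andP=> i0 ile; have := @count_bump_rel (fun p => t < p) i.
rewrite i0 /= leqW // => /(_ isT).
rewrite [in X in _ = X](_ : index_iota i.+1 n.+2 = index_iota i.+1 n.+1 ++ [:: n.+1]).
  by rewrite count_cat /J /=; lia.
rewrite /index_iota (_ : n.+2 - i.+1 = n - i + 1) ?iotaD; last by lia.
by rewrite subSS /= addSn subnKC.
Qed.

(** At a bump [w i] is the letter in hand, which does not exceed itself. Elsewhere the hand is
    unchanged and raises the bound by one exactly when it holds a larger letter; this extra one is
    what lets the marks reveal the bumps. *)
Lemma E_bump_rel i : 0 < i <= n ->
  E n w i = if A i.+1 then J n u i.+1 (c i) else E n u i.+1 + (w i < c i.+1).
Proof.
move=> ile; rewrite /E J_bump_rel //; case: H => _ _ /(_ i ile).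
by case: ifP => _ [-> cS]; rewrite ?ltnn ?addn0 ?cS.
Qed.

End BumpRel.

Lemma bumping_seq_rel n u a : bumping_seq n u a ->
  bump_rel n u (bump_word u a) (carry u a) (mem a).
Proof.
case/and4P=> sa /eqP ha /eqP la _; split; first exact: carry1.
  rewrite carryS // -la -{1}(nth_last 0 a) mem_nth //.
  by move: ha; case: (a).
move=> i /andP[i0 _]; rewrite bump_wordE // carryS //.
by change (mem a i.+1) with (i.+1 \in a); case: (i.+1 \in a).
Qed.

Lemma eq_J n u w i t : 0 < i -> (forall j, 0 < j <= n -> u j = w j) ->
  J n u i t = J n w i t.
Proof.
move=> i0 uw; congr (_ + _); apply: eq_in_count => l.
rewrite mem_index_iota => /andP[il ln]; rewrite uw //; lia.
Qed.

Lemma eq_E n u w i : 0 < i <= n -> (forall j, 0 < j <= n -> u j = w j) ->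
  E n u i = E n w i.
Proof. by move=> i0 uw; rewrite /E uw // (eq_J _ _ uw) //; case/andP: i0. Qed.

(** * Reading a bump backwards from its target *)

Section Unbump.
(* [N] is the letter read at position [n.+1]. *)
Variables (n N : nat) (w x : nat -> nat).

Definition ejects i d := (x i == E n w i) && (w i < d).

(** Recursion on the distance [k = n.+1 - i] to the end makes the right-to-left scan structural. *)
Fixpoint uncarry_from_end k : nat :=
  if k is k'.+1 then
    let d := uncarry_from_end k' in if ejects (n - k') d then w (n - k') else d
  else N.

Definition uncarry i := uncarry_from_end (n.+1 - i).

Definition unbump_pos i := (i == 1) || ejects i.-1 (uncarry i).

Definition unbump_seq := [seq i <- index_iota 1 n.+2 | unbump_pos i].

(** A letter picked up at [i] is in hand right after [i]; any other letter was only shifted one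
    place to the left. *)
Definition unbump_word i := if unbump_pos i then uncarry i else w i.-1.

Lemma uncarry_end : uncarry n.+1 = N.
Proof. by rewrite /uncarry subnn. Qed.

Lemma uncarryE i : i <= n ->
  uncarry i = if ejects i (uncarry i.+1) then w i else uncarry i.+1.
Proof.
move=> ile; rewrite /uncarry (_ : n.+1 - i = (n.+1 - i.+1).+1); last by lia.
by rewrite [LHS]/= (_ : n - (n.+1 - i.+1) = i) //; lia.
Qed.

Lemma mem_unbump_seq i :
  (i \in unbump_seq) = (0 < i <= n.+1) && unbump_pos i.
Proof. by rewrite mem_filter mem_index_iota andbC ltnS. Qed.

Lemma unbump_seq_sorted : sorted ltn unbump_seq.
Proof. by rewrite sorted_filter ?iota_ltn_sorted //; exact: ltn_trans. Qed.

Lemma bump_inj u x0 a :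
  bumping_seq n u a -> u n.+1 = N ->
  (forall i, 0 < i <= n -> w i = bump_word u a i) ->
  (forall i, 0 < i <= n -> x i = bump_mark n u x0 a i) ->
  (forall i, 0 < i <= n -> x0 i <= E n u i) ->
  a = unbump_seq /\ forall i, 0 < i <= n.+1 -> u i = unbump_word i.
Proof.
move=> ba uN Hw Hx Hx0; have [c1 cN Hc] := bumping_seq_rel ba.
have HE := E_bump_rel (bumping_seq_rel ba).
case/and4P: (ba) => sa /eqP ha /eqP la _.
have cu := elimT (bumping_seqP u sa ha la) ba.
have Na : n.+1 \in a by rewrite -la -(nth_last 0 a) mem_nth //; move: ha; case: (a).
have an i : i \in a -> i <= n.+1.
  by rewrite -la; exact: sorted_leq_last.
have Ej i : 0 < i <= n -> (i.+1 \in a) = ejects i (carry u a i.+1).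
  move=> ile; rewrite /ejects Hx // /bump_mark /bumped.
  have i0 : 0 < i by case/andP: ile.
  rewrite mem_behead_bump_seq // (eq_E ile Hw) Hw //.
  have := HE _ ile; have := Hc _ ile; rewrite /=; case: ifP => ia [-> ->] ->.
    by rewrite eqxx cu.
  (* Without a bump, [x i = x0 i.+1] is at most [E n u i.+1], below [E n w i] if the hand holds a
     larger letter. The case [i = n] cannot occur, since [n.+1] is in [a]. *)
  have [in_|] := leqP i.+1 n; last first.
    by move=> ni; move: ia; rewrite (_ : i.+1 = n.+1) ?Na //; lia.
  by have le_x0 := Hx0 i.+1 in_; case: (u _ < carry _ _ _); lia.
(* Both hands hold [N] at the end and, by [Ej], change at the same positions. *)
have cE i : 0 < i <= n.+1 -> carry u a i = uncarry i.
  case/andP=> i0; move Ek : (n.+1 - i) => k; elim: k i i0 Ek => [|k IHk] i i0 Ek ile.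
    by rewrite (_ : i = n.+1) ?uncarry_end ?cN //; lia.
  have ile' : 0 < i <= n by lia.
  rewrite uncarryE; last by lia.
  rewrite -IHk -?Ej //; try by lia.
  by have := Hc _ ile'; rewrite -Hw //=; case: ifP => _ [].
have ma i : 0 < i <= n.+1 -> (i \in a) = unbump_pos i.
  case: i => // -[|i] ile; first by rewrite (one_in_bump_seq ha).
  by rewrite Ej ?cE //; lia.
split.
  apply: (irr_sorted_eq ltn_trans ltnn sa unbump_seq_sorted) => i.
  rewrite mem_unbump_seq; case: (boolP (0 < i <= n.+1)) => [/ma//|] /=.
  apply: contraNF => ia; rewrite an // andbT; exact: (bump_seq_gt0 sa ha).
move=> i ile; rewrite /unbump_word -ma // -cE //.
case: i ile => // i ile; case: ifP => ia; first by rewrite carryS // ia.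
case: i ia ile => [|i] ia ile; first by rewrite (one_in_bump_seq ha) in ia.
have ile' : 0 < i.+1 <= n by lia.
by rewrite Hw //; have := Hc _ ile'; rewrite /= ia; case.
Qed.

(** * The backward reading always yields a legal bump *)

Section Existence.
Variable u : nat -> nat.
Hypotheses (n0 : 0 < n) (wN : w n < N).
Hypothesis Hx : forall i, 0 < i <= n -> 0 < x i <= E n w i.
Hypothesis Hu : forall i, 0 < i <= n.+1 -> u i = unbump_word i.

(** Since [E n w n = 1], the positive mark [x n] is maximal, and the letter in hand there is [N],
    larger than [w n]. *)
Lemma unbump_pos_end : unbump_pos n.+1.
Proof.
rewrite /unbump_pos /ejects uncarry_end /= wN andbT.
have := @Hx n; rewrite n0 leqnn => /(_ isT).
by rewrite /E /J /index_iota subSn // subnn /= ltnn; lia.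
Qed.

Lemma unbump_rel : bump_rel n u w uncarry unbump_pos.
Proof.
split; first by rewrite Hu.
  by rewrite Hu ?leqnn // /unbump_word unbump_pos_end.
move=> i ile; rewrite Hu; last by lia.
rewrite /unbump_word (@uncarryE i); last by lia.
have -> : unbump_pos i.+1 = ejects i (uncarry i.+1) by case: i ile.
by case: (ejects _ _).
Qed.

Lemma head_unbump_seq : head 0 unbump_seq = 1.
Proof. by rewrite /unbump_seq /index_iota subSS subn0. Qed.

Lemma last_unbump_seq : last 0 unbump_seq = n.+1.
Proof.
rewrite /unbump_seq /index_iota subSS subn0 -[X in iota 1 X]addn1 iotaD filter_cat last_cat /=.
by rewrite add1n unbump_pos_end.
Qed.

Lemma carry_unbump i : 0 < i <= n.+1 -> carry u unbump_seq i = uncarry i.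
Proof.
have [c1 _ Hc] := unbump_rel.
have sa := unbump_seq_sorted; have ha := head_unbump_seq.
elim: i => // -[|i] IHi ile; first by rewrite carry1.
rewrite carryS // mem_unbump_seq ile IHi; last by lia.
have ile' : 0 < i.+1 <= n by lia.
by have := Hc _ ile'; rewrite [_ && _]/=; case: ifP => _ [_ ->].
Qed.

(** The letters increase along the sequence because [ejects] demands that the ejected letter be
    smaller than the one then picked up. *)
Lemma unbump_bumping : bumping_seq n u unbump_seq.
Proof.
have [c1 _ Hc] := unbump_rel.
apply/(bumping_seqP u unbump_seq_sorted head_unbump_seq last_unbump_seq) => i i0.
rewrite mem_unbump_seq => /andP[ile pi].
have ile' : 0 < i <= n by lia.
have := Hc _ ile'; rewrite pi carry_unbump; last by lia.
by case=> <- <-; move: pi; rewrite /unbump_pos; case: (i) i0 => // j _ /andP[].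
Qed.

Lemma unbump_wordK i : 0 < i <= n -> bump_word u unbump_seq i = w i.
Proof.
move=> ile; have [c1 _ Hc] := unbump_rel.
rewrite bump_wordE ?unbump_seq_sorted ?head_unbump_seq //; last by case/andP: ile.
rewrite carry_unbump; last by lia.
by have := Hc _ ile; rewrite mem_unbump_seq !ltnS (andP ile).2 /=; case: ifP => _ [->].
Qed.

(** At a bump [x i] is already maximal by [ejects], so the source mark at [i.+1] is
    unconstrained. *)
Lemma unbump_markE x0 i : 0 < i <= n ->
  (x i == bump_mark n u x0 unbump_seq i)
  = (i.+1 \in unbump_seq) || (x0 i.+1 == x i).
Proof.
move=> ile; have i0 : 0 < i by case/andP: ile.
rewrite /bump_mark /bumped mem_behead_bump_seq ?head_unbump_seq //.
case: ifP => ia; last by rewrite eq_sym.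
rewrite (eq_E ile unbump_wordK); move: ia; rewrite mem_unbump_seq => /andP[_].
by rewrite /unbump_pos; case: (i) i0 => // j _ /andP[].
Qed.

(** Makes copying the mark back to the source legal: if [i] does not eject, either the two bounds
    agree or [x i] is not maximal and the bound drops by only one. *)
Lemma unbump_mark_le i : 0 < i <= n -> i.+1 \notin unbump_seq ->
  x i <= E n u i.+1.
Proof.
move=> ile; rewrite mem_unbump_seq !ltnS (andP ile).2 /= => ni.
have := E_bump_rel unbump_rel ile; rewrite (negPf ni).
have := Hx ile; move: ni; rewrite /unbump_pos negb_or /ejects /=.
by case: (w i < _); lia.
Qed.

(** Identifies the numerators of the transition probability with the weights of the target marks at
    the bumps. *)
Lemma unbump_J i : 0 < i <= n -> i.+1 \in unbump_seq ->
  J n u i.+1 (carry u unbump_seq i) = x i.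
Proof.
move=> ile; rewrite mem_unbump_seq => /andP[_ pi].
have := E_bump_rel unbump_rel ile; rewrite pi carry_unbump; last by lia.
move=> <-; move: pi; rewrite /unbump_pos; case: (i) ile => // j _ /andP[/eqP -> //].
Qed.

End Existence.
End Unbump.

(** * Products over ranks turned into products over positions *)

Section BumpProducts.
Variables (R : comPzRingType) (n : nat) (a : seq nat) (G : nat -> R).
Hypotheses (sa : sorted ltn a) (ha : head 0 a = 1) (la : last 0 a = n.+1).
Local Open Scope ring_scope.

Lemma prod_behead_bump_seq :
  \prod_(1 <= j < size a) G (nth 0%N a j)
  = \prod_(1 <= p < n.+1 | p.+1 \in a) G p.+1.
Proof.
have ua := bump_seq_uniq sa.
have -> : \prod_(1 <= p < n.+1 | p.+1 \in a) G p.+1 = \prod_(2 <= p < n.+2 | p \in a) G p.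
  by rewrite [RHS]big_add1.
case: {+}a sa ha la ua => //= b s ps b1; rewrite {b}b1 in ps * => ls /andP[s1 us].
rewrite big_add1 /= -(big_nth 0%N xpredT G) -[RHS]big_filter.
apply: perm_big; apply: uniq_perm => //; first by rewrite filter_uniq ?iota_uniq.
move=> i; rewrite mem_filter mem_index_iota inE andbC.
have [is_|_] := boolP (i \in s); last by rewrite orbF; lia.
have /allP/(_ _ is_) := order_path_min ltn_trans ps.
have := @sorted_leq_last (1 :: s)%N i ps.
rewrite inE is_ orbT /= ls => /(_ isT); lia.
Qed.

Lemma prod_belast_bump_seq :
  \prod_(1 <= j < size a) G (nth 0%N a j.-1)
  = \prod_(1 <= p < n.+1 | p \in a) G p.
Proof.
have ua := bump_seq_uniq sa; have a0 := bump_seq_gt0 sa ha.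
have aN i := @sorted_leq_last a i sa; rewrite la in aN.
case/lastP: {+}a la ua a0 aN => [|s b]; first by rewrite !big_nil.
rewrite last_rcons => -> {b}; rewrite rcons_uniq => /andP[sN us] a0 aN.
rewrite size_rcons big_add1 /=.
rewrite (eq_big_nat _ _ (F2 := fun j => G (nth 0%N s j))); last first.
  by move=> j /andP[_ js]; rewrite nth_rcons js.
rewrite -(big_nth 0%N xpredT G) -[RHS]big_filter.
apply: perm_big; apply: uniq_perm => //; first by rewrite filter_uniq ?iota_uniq.
move=> i; rewrite mem_filter mem_index_iota mem_rcons inE.
have [is_|_] := boolP (i \in s); last by rewrite orbF; lia.
have := a0 i; have := aN i; rewrite mem_rcons inE is_ orbT => /(_ isT) iN /(_ isT).
have : i != n.+1 by apply: contraNneq sN => <-.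
lia.
Qed.

End BumpProducts.

Lemma bump_weightE (R : realFieldType) T (nn : 'I_T -> nat) (z : nat -> R) u a :
  sorted ltn a -> head 0 a = 1 -> last 0 a = (len nn).+1 ->
  bump_weight nn z u a =
  (\prod_(1 <= p < (len nn).+1 | p.+1 \in a) z (J (len nn) u p.+1 (carry u a p))
   / \prod_(1 <= p < (len nn).+1 | p \in a) y z (E (len nn) u p))%R.
Proof.
move=> sa ha la; rewrite /bump_weight big_add1 /= prodf_div; congr (_ / _)%R.
  rewrite -(prod_behead_bump_seq (fun p => z (J (len nn) u p (carry u a p.-1))) sa ha la).
  by apply: eq_big_nat => j jk; rewrite carry_nth.
by rewrite -(prod_belast_bump_seq (fun p => y z (E (len nn) u p)) sa ha la).
Qed.

(** * Passing between tuples and functions on positions *)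

Section Tuples.
Variables (T : nat) (nn : 'I_T -> nat).
Local Notation n := (len nn).
Implicit Types (w : n.-tuple 'I_T) (v : n.-tuple 'I_n.+2).

Lemma letterE w (i : 'I_n) : letter w i.+1 = (tnth w i).+1.
Proof.
rewrite /letter /= (nth_map (tnth w i)) ?size_tuple //.
by rewrite -tnth_nth.
Qed.

Lemma letter_end w : letter w n.+1 = T.+1.
Proof. by rewrite /letter nth_default // size_map size_tuple. Qed.

Lemma markE v (i : 'I_n) : mark v i.+1 = tnth v i.
Proof.
rewrite /mark /= (nth_map (tnth v i)) ?size_tuple //.
by rewrite -tnth_nth.
Qed.

Lemma count_letter w (P : pred nat) :
  count (fun l => P (letter w l)) (index_iota 1 n.+1)
  = count (fun c : 'I_T => P c.+1) w.
Proof.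
rewrite /index_iota subSS subn0 (iotaDl 1 0) count_map -val_enum_ord count_map.
rewrite -[in RHS](map_tnth_enum w) count_map; apply: eq_count => i /=.
by rewrite add1n letterE.
Qed.

Lemma exists_word (f : nat -> nat) w' :
    (forall P : pred nat,
      count (fun l => P (letter w' l)) (index_iota 1 n.+1)
      = count (fun l => P (f l)) (index_iota 1 n.+1)) ->
    w' \in St nn ->
  exists2 w, w \in St nn & forall i, 0 < i <= n -> letter w i = f i.
Proof.
move=> Hf; rewrite inE => /forallP stw'.
have fP i : 0 < i <= n -> 0 < f i <= T.
  (* Counting letters outside [1..T] gives zero for [w'], hence for [f]; so the default of [insubd]
     below is never taken. *)
  move=> ile; have := Hf (fun p => ~~ (0 < p <= T)); rewrite (count_letter w' (fun p => ~~ (0 < p <= T))).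
  rewrite (eq_count (a2 := pred0)) => [|c]; last by rewrite /= ltn_ord.
  rewrite count_pred0 => /esym/eqP; rewrite eqn0Ngt -has_count => /hasPn /(_ i).
  by rewrite mem_index_iota ltnS negbK; apply.
pose w := [tuple insubd (tnth w' i) (f i.+1).-1 | i < n].
have lw i : 0 < i <= n -> letter w i = f i.
  case: i => // i ile; rewrite (letterE w (Ordinal ile)) tnth_mktuple.
  have := fP _ ile; rewrite val_insubd; case: (f _) => //= m -> //.
exists w => //; rewrite inE; apply/forallP => c; rewrite -(eqP (stw' c)); apply/eqP.
have := count_letter w (pred1 c.+1); rewrite /= => <-.
have := count_letter w' (pred1 c.+1); rewrite /= => <-.
rewrite (Hf (pred1 c.+1)); apply: eq_in_count => l.
by rewrite mem_index_iota ltnS /= => /lw ->.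
Qed.

End Tuples.

Lemma J_leq n u i t : 0 < i -> J n u i t <= n.+1.
Proof.
move=> i0; rewrite /J add1n ltnS (leq_trans (count_size _ _)) // size_iota; lia.
Qed.

(** * The sources of a fixed target and their total weight *)

Section Predecessors.
Variables (T : nat) (nn : 'I_T -> nat).
Local Notation n := (len nn).
Local Notation state := (enriched_state nn).
Hypothesis n0 : 0 < n.

Lemma wordof_end (s : state) : wordof s n.+1 = T.+1.
Proof. exact: letter_end. Qed.

Lemma markof_bounds (s : state) i : 0 < i <= n ->
  0 < markof s i <= E n (wordof s) i.
Proof.
case: i => // i ile; case/andP: (valP s) => _ /forallP /(_ (Ordinal ile)).
by [].
Qed.

Variable s' : state.
Local Notation w' := (wordof s').
Local Notation x := (markof s').
Local Notation a0 := (unbump_seq n T.+1 w' x).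

Lemma wordof_last_lt : w' n < T.+1.
Proof.
have lt_n : n.-1 < n by rewrite prednK.
have := letterE (val s').1 (Ordinal lt_n); rewrite /= prednK // /wordof => ->.
by rewrite ltnS ltn_ord.
Qed.
Let wN := wordof_last_lt.
Let Hx := markof_bounds s'.

Lemma exists_unbump_word :
  exists2 w0, w0 \in St nn &
    forall i, 0 < i <= n.+1 -> letter w0 i = unbump_word n T.+1 w' x i.
Proof.
have [||w0 stw0 Hw0] := @exists_word _ _ (unbump_word n T.+1 w' x) (val s').1.
- by move=> P; apply: (count_bump_rel1 (unbump_rel n0 wN Hx _)).
- by case/andP: (valP s').
exists w0 => // i /andP[i0]; rewrite leq_eqVlt => /predU1P[->|ile]; last first.
  by rewrite Hw0 // i0.
by rewrite letter_end /unbump_word (unbump_pos_end n0 wN Hx) uncarry_end.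
Qed.

(** Ensures that the search by [pick] in [transition] can reach [a0]. *)
Lemma seq_of_unbump_seq : exists b0 : seq_index nn, seq_of b0 = a0.
Proof.
have sz : size [seq inord i : 'I_n.+2 | i <- a0] <= n.+1.
  by rewrite size_map size_filter (leq_trans (count_size _ _)) // size_iota subSS subn0.
exists (Bseq sz); rewrite /seq_of -map_comp -[RHS]map_id.
apply/eq_in_map => i /=.
by rewrite mem_unbump_seq => /andP[/andP[_ ile] _]; rewrite inordK.
Qed.

Lemma is_bumpP (s : state) a :
  reflect ((forall i, 0 < i <= n -> w' i = bump_word (wordof s) a i)
        /\ (forall i, 0 < i <= n -> x i = bump_mark n (wordof s) (markof s) a i))
    (is_bump s s' a).
Proof.
apply: (iffP forallP) => [H|[H1 H2] i].
  by split=> -[//|i] ile; have /andP[/eqP ? /eqP ?] := H (Ordinal ile).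
by rewrite H1 ?H2 ?eqxx //= ltn_ord.
Qed.

Lemma bump_to_inj (s : state) a :
  bumping_seq n (wordof s) a -> is_bump s s' a ->
  a = a0 /\ forall i, 0 < i <= n.+1 ->
    wordof s i = unbump_word n T.+1 w' x i.
Proof.
move=> ba /is_bumpP[H1 H2]; apply: (bump_inj ba _ H1 H2); first exact: wordof_end.
by move=> i /(markof_bounds s) /andP[].
Qed.

Lemma transitionE (R : realFieldType) (z : nat -> R) (s : state) :
  transition z s s' =
  if bumping_seq n (wordof s) a0 && is_bump s s' a0
  then bump_weight nn z (wordof s) a0 else 0%R.
Proof.
rewrite /transition; case: pickP => [b /andP[bb sb]|nob].
  by have [<- _] := bump_to_inj bb sb; rewrite bb sb.
by have [b0 <-] := seq_of_unbump_seq; rewrite nob.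
Qed.

Variable w0 : n.-tuple 'I_T.
Hypothesis stw0 : w0 \in St nn.
Hypothesis Hw0 :
  forall i, 0 < i <= n.+1 -> letter w0 i = unbump_word n T.+1 w' x i.

Definition bump_source (s : state) : bool :=
  ((val s).1 == w0) &&
  [forall i : 'I_n, (i.+1 \in a0) || (markof s i.+1 == x i)].

Lemma bump_sourceE (s : state) :
  bumping_seq n (wordof s) a0 && is_bump s s' a0 = bump_source s.
Proof.
apply/andP/andP => [[ba sb]|[/eqP sw0 /forallP Hs]].
  have [_ Hs] := bump_to_inj ba sb.
  have sw0 : (val s).1 = w0.
    apply: eq_from_tnth => i; apply: val_inj; apply: succn_inj.
    by rewrite -!letterE Hw0 -?Hs //= ltnS ltnW.
  split; first exact/eqP.
  apply/forallP => -[[|i] ile] //=.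
  have ile' : 0 < i.+1 <= n by exact: ltnW ile.
  have /is_bumpP[_ /(_ _ ile')/eqP] := sb.
  by rewrite /wordof sw0 (unbump_markE n0 wN Hx Hw0).
have ws : wordof s = letter w0 by rewrite /wordof sw0.
rewrite ws; split; first exact: (unbump_bumping n0 wN Hx Hw0).
apply/is_bumpP; rewrite ws; split=> i ile.
  by rewrite (unbump_wordK n0 wN Hx Hw0).
apply/eqP; rewrite (unbump_markE n0 wN Hx Hw0) //.
(* For [i = n] the next position [n.+1] lies in [a0], so no mark past the end is compared. *)
case/andP: ile => i0; rewrite leq_eqVlt => /predU1P[->|ile].
  by rewrite mem_unbump_seq (unbump_pos_end n0 wN Hx) leqnn.
by have := Hs (Ordinal ile).
Qed.

Local Open Scope ring_scope.
Variables (R : realFieldType) (z : nat -> R).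

Definition source_mark (i : 'I_n) (c : 'I_n.+2) : bool :=
  if i.+1 \in a0 then (0 < c <= E n (letter w0) i.+1)%N else c == x i :> nat.

(** The mark conditions at different positions are independent, so sources correspond to functions
    chosen pointwise and the sum factorises. *)
Lemma sum_source_weight :
  \sum_(s | bump_source s) state_weight z s
  = \prod_(i < n) \sum_(c | source_mark i c) z c.
Proof.
(* The default [s'] only serves functions that do not give an enriched state. *)
pose h (f : {ffun 'I_n -> 'I_n.+2}) : state := insubd s' (w0, [tuple f i | i < n]).
pose h' (s : state) : {ffun 'I_n -> 'I_n.+2} := [ffun i => tnth (val s).2 i].
have hE (f : {ffun 'I_n -> 'I_n.+2}) : is_enriched (w0, [tuple f i | i < n]) ->
    val (h f) = (w0, [tuple f i | i < n]).
  by move=> ef; rewrite val_insubd ef.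
rewrite bigA_distr_big_dep (reindex_onto h h') => [|s /andP[/eqP sw0 _]].
  apply: eq_big => [f|f /andP[_ /eqP hf]].
    apply/andP/familyP => [[/andP[/eqP sw0 /forallP Hs] /eqP hf] i|Hf].
      rewrite -[_ \in _]/(source_mark i (f i)) /source_mark; have := Hs i; rewrite /markof markE.
      have -> : tnth (val (h f)).2 i = f i by rewrite -[in RHS]hf ffunE.
      case: ifP => // _ _; case/andP: (valP (h f)) => _ /forallP/(_ i).
      by rewrite markE sw0; rewrite -[in X in _ -> X]hf ffunE.
    have ef : is_enriched (w0, [tuple f i | i < n]).
      rewrite /is_enriched stw0; apply/forallP => i; rewrite markE tnth_mktuple.
      have := Hf i; rewrite -[_ \in _]/(source_mark i (f i)) /source_mark; case: ifP => // ia /eqP ->.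
      case: i ia => -[|i] ile /= ia; first by rewrite mem_unbump_seq in ia.
      have ile' : (0 < i.+1 <= n)%N by exact: ltnW ile.
      rewrite (unbump_mark_le n0 wN Hx Hw0) ?ia // andbT.
      by have /andP[] := Hx ile'.
    split; last by apply/eqP/ffunP => i; rewrite ffunE hE // tnth_mktuple.
    rewrite /bump_source hE // eqxx; apply/forallP => i.
    rewrite /markof hE // markE tnth_mktuple.
    by have := Hf i; rewrite -[_ \in _]/(source_mark i (f i)) /source_mark; case: ifP.
  rewrite /state_weight big_add1 /= big_mkord; apply: eq_bigr => i _.
  by rewrite /markof markE -[in RHS]hf ffunE.
have E_ : (w0, [tuple h' s i | i < n]) = val s.
  rewrite -sw0 [RHS]surjective_pairing; congr (_, _).
  by apply: eq_from_tnth => i; rewrite tnth_mktuple ffunE.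
by apply: val_inj; rewrite hE E_ ?(valP s).
Qed.

Lemma sum_source_mark (i : 'I_n) :
  \sum_(c | source_mark i c) z c
  = if i.+1 \in a0 then y z (E n (letter w0) i.+1) else z (x i).
Proof.
rewrite /source_mark; case: ifP => ia.
  have leE : (E n (letter w0) i.+1 < n.+2)%N by rewrite ltnS J_leq.
  rewrite /y (big_nat_widen _ _ _ _ _ leE) big_geq_mkord.
  by apply: eq_bigl => c; rewrite andbC.
case: i ia => -[|i] ile /= ia; first by rewrite mem_unbump_seq in ia.
have ile' : (0 < i.+1 <= n)%N by exact: ltnW ile.
have lt_x : (x i.+1 < n.+2)%N.
  by have /andP[_ xE] := Hx ile'; rewrite ltnS (leq_trans xE) // J_leq.
by rewrite (big_pred1 (Ordinal lt_x)).
Qed.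

Hypothesis hz : forall i : nat, (1 <= i)%N -> 0 < z i.

Lemma y_gt0 i : (0 < i)%N -> 0 < y z i.
Proof.
move=> i0; rewrite /y big_ltn // ltr_wpDr ?hz // big_nat_cond.
by apply: sumr_ge0 => j; rewrite andbT => /andP[j1 _]; rewrite ltW // hz // ltnW.
Qed.

Lemma source_balance :
  \sum_(s | bump_source s) state_weight z s * bump_weight nn z (letter w0) a0
  = state_weight z s'.
Proof.
have m1 : 1%N \in a0 by rewrite mem_unbump_seq.
have mN : n.+1 \in a0.
  by rewrite mem_unbump_seq (unbump_pos_end n0 wN Hx) leqnn.
rewrite -mulr_suml sum_source_weight (eq_bigr _ (fun i _ => sum_source_mark i)).
rewrite bump_weightE ?unbump_seq_sorted ?head_unbump_seq ?(last_unbump_seq n0 wN Hx) //.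
have -> : \prod_(1 <= p < n.+1 | p.+1 \in a0)
    z (J n (letter w0) p.+1 (carry (letter w0) a0 p))
   = \prod_(1 <= p < n.+1 | p.+1 \in a0) z (x p).
  rewrite big_nat_cond [RHS]big_nat_cond; apply: eq_bigr => p /andP[pn pa].
  by rewrite (unbump_J n0 wN Hx Hw0).
have -> : \prod_(i < n)
    (if i.+1 \in a0 then y z (E n (letter w0) i.+1) else z (x i))
  = \prod_(1 <= p < n.+1 | p \in a0) y z (E n (letter w0) p)
    * \prod_(1 <= p < n.+1 | p.+1 \notin a0) z (x p).
  rewrite -(big_mkord xpredT (fun i =>
    if i.+1 \in a0 then y z (E n (letter w0) i.+1) else z (x i))).
  rewrite (bigID (fun i => i.+1 \in a0)) /=; congr (_ * _).
    by rewrite [RHS]big_add1 /=; apply: eq_bigr => i ->.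
  rewrite (eq_bigr (fun i => z (x i))); last by move=> i /negPf ->.
  (* The ranges [0 <= i < n] and [1 <= p <= n] differ only at [i = 0] and [p = n], which contribute
     1 because [1] and [n.+1] lie in [a0]. *)
  rewrite big_mkcond [RHS]big_mkcond big_ltn // m1 /= mul1r.
  by rewrite [RHS]big_nat_recr //= mN mulr1.
rewrite [X in X * _]mulrC -mulrA [X in _ * X]mulrCA divff ?mulr1.
  by rewrite /state_weight [RHS](bigID (fun p => p.+1 \in a0)) /= mulrC.
apply: lt0r_neq0; rewrite big_nat_cond; apply: prodr_gt0 => p _.
exact: y_gt0.
Qed.

End Predecessors.

(** * Positivity of the normalization constant *)

Section Positivity.
Local Open Scope ring_scope.
Variables (R : realFieldType) (T : nat) (nn : 'I_T -> nat) (z : nat -> R).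
Hypothesis hz : forall i : nat, (1 <= i)%N -> 0 < z i.

Lemma state_weight_gt0 (s : enriched_state nn) : 0 < state_weight z s.
Proof.
rewrite /state_weight big_nat_cond; apply: prodr_gt0 => i.
by rewrite andbT ltnS => /(markof_bounds s) /andP[/hz].
Qed.

Lemma enriched_state_nonempty : (0 < #|{: enriched_state nn}|)%N.
Proof.
(* Witness: the letters in nondecreasing order with all marks 1, allowed since [J] is at least 1. *)
pose r := flatten [seq nseq (nn c) c | c <- enum 'I_T].
have sz : size r == len nn.
  rewrite size_flatten /shape -map_comp sumnE big_map big_enum /= /len.
  by apply/eqP; apply: eq_bigr => c _; rewrite size_nseq.
pose v : (len nn).-tuple 'I_(len nn).+2 := [tuple inord 1 | i < len nn].
have es : is_enriched (Tuple sz, v).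
  apply/andP; split.
    rewrite inE; apply/forallP => c; rewrite /= count_flatten -map_comp sumnE.
    rewrite big_map big_enum /= (bigD1 c) //= count_nseq /= eqxx mul1n.
    rewrite big1 ?addn0 // => d dc; rewrite count_nseq /=.
    by rewrite (negPf dc).
  by apply/forallP => i; rewrite markE tnth_mktuple inordK.
by apply/card_gt0P; exists (Sub _ es).
Qed.

Lemma Z_gt0 : 0 < Z nn z.
Proof.
have /card_gt0P[s _] := enriched_state_nonempty; rewrite /Z (bigD1 s) //=.
by rewrite ltr_wpDr ?state_weight_gt0 // sumr_ge0 // => *; rewrite ltW ?state_weight_gt0.
Qed.

End Positivity.

(** * Stationarity *)

Local Open Scope ring_scope.

Theorem theorem2p5 (R : realFieldType) (T : nat) (nn : 'I_T -> nat)
    (z : nat -> R)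
    (hT : (1 <= T)%N)
    (hnn : forall i : 'I_T, (1 <= nn i)%N)
    (hz : forall i : nat, (1 <= i)%N -> 0 < z i) :
  @stationary_distribution R (enriched_state nn)
    (@transition T nn R z) (@pi_tilde T nn R z).
Proof.
have n0 : (0 < len nn)%N.
  by rewrite /len (bigD1 (Ordinal hT)) //= ltn_addr ?hnn.
have Z0 := Z_gt0 nn hz; split.
  split=> [s|]; first by rewrite mulr_ge0 ?invr_ge0 ?ltW ?state_weight_gt0.
  by rewrite -mulr_sumr mulVf // lt0r_neq0.
move=> s'; have [w0 stw0 Hw0] := exists_unbump_word n0 s'.
(* Expanding the target weight over its sources lets the two sums be compared term by term, other
   states contributing 0. *)
rewrite /pi_tilde -(source_balance n0 stw0 Hw0 hz) mulr_sumr [RHS]big_mkcond.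
apply: eq_bigr => s _; rewrite transitionE // (bump_sourceE n0 Hw0).
case: ifP => [/andP[/eqP sw0 _]|_]; last by rewrite mulr0.
by rewrite /wordof sw0 mulrA.
Qed.
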